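(* Let $V$ be an ungraded vector space, considered as a graded space concentrated in degree $0$, and let $\lambda\in\mathbf{k}$. Then a Rota-Baxter algebra structure of weight $\lambda$ on $V$ is equivalent to a Maurer-Cartan element in the $L_\infty$-algebra $\mathfrak{C}_{\mathrm{RBA}_\lambda}(V)$ described in the context. That is, the assignment $(m,\tau)\mapsto(\mu,T)$ with $\mu=s^{-1}\circ m\circ(s\otimes s)$ and $T=\tau\circ s$ is a bijection from the set of Maurer-Cartan elements $(m,\tau)\in\mathrm{Hom}((sV)^{\otimes2},sV)\oplus\mathrm{Hom}(sV,V)=\mathfrak{C}_{\mathrm{RBA}_\lambda}(V)_{-1}$ onto the set of pairs $(\mu,T)$ such that $(V,\mu,T)$ is a Rota-Baxter algebra of weight $\lambda$.
   Context: **Rota-Baxter algebras.** A Rota-Baxter algebra of weight $\lambda$ is a triple $(V,\mu,T)$ with $(V,\mu=\cdot)$ an associative $\mathbf{k}$-algebra and $T:V\to V$ linear with $T(a)\cdot T(b)=T(a\cdot T(b)+T(a)\cdot b+\lambda\,a\cdot b)$ for all $a,b\in V$. **Conventions.** $\mathbf{k}$ is a field of characteristic $0$; all spaces, tensor products and Hom-spaces are over $\mathbf{k}$. Graded spaces are homologically graded; $\mathrm{Hom}(V,W)_r=\prod_p\mathrm{Hom}(V_p,W_{p+r})$. The suspension $sV$ has $(sV)_n=V_{n-1}$; $s:V\to sV$ has degree $1$ and $s^{-1}$ has degree $-1$. For a map $f$ with values in $V$, $sf:=s\circ f$, so $|sf|=|f|+1$. The Koszul sign rule is used, e.g. $(f\otimes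 g)(v\otimes w)=(-1)^{|g||v|}f(v)\otimes g(w)$. $T^c(sV)=\bigoplus_{n\geqslant 0}(sV)^{\otimes n}$. We write $sa_{i,j}$ for $sa_i\otimes\cdots\otimes sa_j$ (empty if $i>j$). For $\sigma\in S_n$, $\epsilon(\sigma;x_1,\dots,x_n)$ is defined by $x_1\odot\cdots\odot x_n=\epsilon(\sigma;x_1,\dots,x_n)\,x_{\sigma(1)}\odot\cdots\odot x_{\sigma(n)}$ in the graded symmetric algebra, and $\chi(\sigma;x_1,\dots,x_n)=\mathrm{sgn}(\sigma)\epsilon(\sigma;x_1,\dots,x_n)$. **Maurer-Cartan elements.** In an $L_\infty$-algebra $(L,\{l_n\}_{n\geqslant1})$ (operations $l_n$ of degree $n-2$), an element $\alpha\in L_{-1}$ is a Maurer-Cartan element if $\sum_{n=1}^\infty\frac1{n!}(-1)^{\frac{n(n-1)}2}l_n(\alpha^{\otimes n})=0$ (the sum is finite here). **Braces.** For homogeneous $f\in\mathrm{Hom}((sV)^{\otimes m},V)$ and $g_i\in\mathrm{Hom}((sV)^{\otimes l_i},V)$, $1\leqslant i\leqslant n$, put $u=m+l_1+\cdots+l_n-n$ and $$sf\{sg_1,\dots,sg_n\}(sa_{1,u})=\sum_{0\leqslant i_1\leqslant i_1+l_1\leqslant i_2\leqslant\cdots\leqslant i_n\leqslant i_n+l_n\leqslant u}(-1)^{\xi}\,sf\big(sa_{1,i_1}\otimes sg_1(sa_{i_1+1,i_1+l_1})\otimes sa_{i_1+l_1+1,i_2}\otimes\cdots\otimes sg_n(sa_{i_n+1,i_n+l_n})\otimes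 sa_{i_n+l_n+1,u}\big),$$ $\xi=\sum_{k=1}^n(|g_k|+1)\sum_{j=1}^{i_k}(|a_j|+1)$. The brace is $0$ if $n>m$, and $sf\{\}=sf$. The Gerstenhaber bracket is $[sf,sg]_G=sf\{sg\}-(-1)^{(|f|+1)(|g|+1)}sg\{sf\}$. **The $L_\infty$-algebra.** $\mathfrak{C}_{\mathrm{Alg}}(V)=\mathrm{Hom}(T^c(sV),sV)$, $\mathfrak{C}_{\mathrm{RBO}_\lambda}(V)=\mathrm{Hom}(T^c(sV),V)$, $\mathfrak{C}_{\mathrm{RBA}_\lambda}(V)=\mathfrak{C}_{\mathrm{Alg}}(V)\oplus\mathfrak{C}_{\mathrm{RBO}_\lambda}(V)$. The operations are given on homogeneous elements of fixed arity by the following rules and extended multilinearly (they form an $L_\infty$-algebra). (I) For $sh\in \mathrm{Hom}(\mathbf{k},sV)=sV$ with $h\in V$: $l_1(sh)=h\in \mathrm{Hom}(\mathbf{k},V)\subset\mathfrak{C}_{\mathrm{RBO}_\lambda}(V)$. (II) For $sf,sh\in\mathfrak{C}_{\mathrm{Alg}}(V)$: $l_2(sf\otimes sh)=[sf,sh]_G$. (III)(i) For $n\geqslant1$, $sh\in\mathrm{Hom}((sV)^{\otimes n},sV)$, $g_1,\dots,g_n\in\mathfrak{C}_{\mathrm{RBO}_\lambda}(V)$: $l_{n+1}(sh\otimes g_1\otimes\cdots\otimes g_n)\in\mathfrak{C}_{\mathrm{RBO}_\lambda}(V)$ is $$\sum_{\sigma\in S_n}(-1)^{\eta}\Big(h\circ(sg_{\sigma(1)}\otimes\cdots\otimes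 sg_{\sigma(n)})-(-1)^{(|g_{\sigma(1)}|+1)(|h|+1)}s^{-1}(sg_{\sigma(1)})\big\{sh\{sg_{\sigma(2)},\dots,sg_{\sigma(n)}\}\big\}\Big),$$ $(-1)^\eta=\chi(\sigma;g_1,\dots,g_n)(-1)^{n(|h|+1)+\sum_{k=1}^{n-1}\sum_{j=1}^k|g_{\sigma(j)}|}$. (III)(ii) For $n\geqslant2$, $1\leqslant m\leqslant n-1$, $sh\in\mathrm{Hom}((sV)^{\otimes n},sV)$, $g_1,\dots,g_m\in\mathfrak{C}_{\mathrm{RBO}_\lambda}(V)$: $$l_{m+1}(sh\otimes g_1\otimes\cdots\otimes g_m)=\sum_{\sigma\in S_m}(-1)^{\xi}\lambda^{n-m}s^{-1}(sg_{\sigma(1)})\big\{sh\{sg_{\sigma(2)},\dots,sg_{\sigma(m)}\}\big\}\in\mathfrak{C}_{\mathrm{RBO}_\lambda}(V),$$ $(-1)^\xi=\chi(\sigma;g_1,\dots,g_m)(-1)^{1+m(|h|+1)+\sum_{k=1}^{m-1}\sum_{j=1}^k|g_{\sigma(j)}|+(|h|+1)(|g_{\sigma(1)}|+1)}$. (IV) For $sh\in\mathrm{Hom}((sV)^{\otimes n},sV)$, $g_1,\dots,g_m\in\mathfrak{C}_{\mathrm{RBO}_\lambda}(V)$, $1\leqslant m\leqslant n$, $1\leqslant k\leqslant m$: $l_{m+1}(g_1\otimes\cdots\otimes g_k\otimes sh\otimes g_{k+1}\otimes\cdots\otimes g_m)=(-1)^{(|h|+1)(\sum_{j=1}^k|g_j|)+k}\,l_{m+1}(sh\otimes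 g_1\otimes\cdots\otimes g_m)$. (V) All other components vanish. *)

(* Defs.v *)
From HB Require Import structures.
From mathcomp Require Import all_boot all_order all_algebra perm.
From mathcomp Require Import mathcomp_extra boolp classical_sets functions.
From mathcomp Require Import cardinality fsbigop.

Set Implicit Arguments.
Unset Strict Implicit.
Unset Printing Implicit Defensive.
Import Order.TTheory GRing.Theory Num.Theory.
Local Open Scope classical_set_scope.
Local Open Scope ring_scope.

(* A graded space (W_p)_(p : int) is given by its total space, the direct sum  *)
(* of the W_p, together with the projections gpr p onto the summands W_p.      *)
Record gradedSpace (k : fieldType) := GradedSpace {
  gsort :> lmodType k ;
  gpr : int -> gsort -> gsort ;
  gpr_linear : forall p, linear (gpr p) ;
  gpr_proj : forall p q a, gpr p (gpr q a) = if p == q then gpr p a else 0 ;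
  gpr_sum : forall a, exists2 s : seq int, uniq s & a = \sum_(p <- s) gpr p a }.

Definition homog (k : fieldType) (W : gradedSpace k) (p : int) (a : W) : bool :=
  gpr p a == a.

Lemma deg0_linear (k : fieldType) (V : lmodType k) (p : int) :
  linear (fun a : V => if p == 0 then a else 0).
Proof. by move=> c a b; case: (p == 0); rewrite ?scaler0 ?addr0. Qed.

Lemma deg0_proj (k : fieldType) (V : lmodType k) (p q : int) (a : V) :
  (if p == 0 then if q == 0 then a else 0 else 0) =
  if p == q then if p == 0 then a else 0 else 0.
Proof.
have [->|p0] := eqVneq p 0; first by rewrite eq_sym.
by case: (p == q).
Qed.

Lemma deg0_sum (k : fieldType) (V : lmodType k) (a : V) :
  exists2 s : seq int, uniq s & a = \sum_(p <- s) if p == 0 then a else 0.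
Proof. by exists [:: 0] => //; rewrite big_seq1 eqxx. Qed.

(* V regarded as a graded space concentrated in degree 0. *)
Definition deg0 (k : fieldType) (V : lmodType k) : gradedSpace k :=
  GradedSpace (@deg0_linear k V) (@deg0_proj k V) (@deg0_sum k V).

Lemma susp_proj (k : fieldType) (V : gradedSpace k) (p q : int) (a : V) :
  gpr (p - 1) (gpr (q - 1) a) = if p == q then gpr (p - 1) a else 0.
Proof. by rewrite gpr_proj (inj_eq (addIr _)). Qed.

Lemma susp_sum (k : fieldType) (V : gradedSpace k) (a : V) :
  exists2 s : seq int, uniq s & a = \sum_(p <- s) gpr (p - 1) a.
Proof.
have [s us {1}->] := gpr_sum a.
exists [seq p + 1 | p <- s]; first by rewrite map_inj_uniq //; exact: addIr.
by rewrite big_map; apply: eq_bigr => p _; rewrite addrK.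
Qed.

(* sV, with (sV)_p = V_(p-1); on total spaces s and its inverse are the        *)
(* identity.                                                                   *)
Definition susp (k : fieldType) (V : gradedSpace k) : gradedSpace k :=
  GradedSpace (fun p => @gpr_linear k V (p - 1)) (@susp_proj k V) (@susp_sum k V).

Definition s_ (k : fieldType) (V : gradedSpace k) : V -> susp V := fun a => a.
Definition sinv (k : fieldType) (V : gradedSpace k) : susp V -> V := fun a => a.

Definition sgi (k : fieldType) (d : int) : k := (-1) ^ d.

(* The linear operator a |-> (-1)^(d|a|) a (for homogeneous a). *)
Definition koszul (k : fieldType) (W : gradedSpace k) (d : int) (a : W) : W :=
  \sum_(p \in [set: int]) sgi k (d * p) *: gpr p a.

(* A linear map from the tensor coalgebra T^c(W) to U is the same thing as a   *)
(* function on words in W which is multilinear on the words of each length;    *)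
(* its value at [:: w_1; ...; w_n] is the image of w_1 (x) ... (x) w_n.        *)
Definition multilinear (k : fieldType) (W U : gradedSpace k)
    (f : seq W -> U) : Prop :=
  forall w1 w2 : seq W, linear (fun a : W => f (w1 ++ a :: w2)).

(* Hom(T^c(W), U)_r *)
Definition HomT (k : fieldType) (W U : gradedSpace k) (r : int) :
    set (seq W -> U) :=
  [set f | multilinear f /\
     forall pw : seq (int * W), all (fun x => homog x.1 x.2) pw ->
       homog (\sum_(x <- pw) x.1 + r) (f [seq x.2 | x <- pw])].
Arguments HomT {k} W U r _.

(* Hom(W^(x)n, U), as a subspace of Hom(T^c(W), U), without degree condition *)
Definition Hom_ar (k : fieldType) (W U : gradedSpace k) (n : nat) :
    set (seq W -> U) :=
  [set f | multilinear f /\ forall w, size w != n -> f w = 0].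
Arguments Hom_ar {k} W U n _.

(* A homogeneous map W^(x)ar -> U of degree dg; hfn is only relevant on words  *)
(* of length ar, and all the maps built below vanish on the other words.       *)
Record hmap (k : fieldType) (W U : gradedSpace k) := HMap {
  ar : nat ; dg : int ; hfn : seq W -> U }.

Definition smap (k : fieldType) (W V : gradedSpace k) (g : hmap W V) :
    hmap W (susp V) :=
  HMap (ar g) (dg g + 1) (fun w => s_ (hfn g w)).

(* [:: a_(p+1); ...; a_q] for w = [:: a_1; ...; a_u] *)
Definition slice (A : Type) (p q : nat) (w : seq A) : seq A :=
  take (q - p) (drop p w).

(* For gis = [:: (g_1, i_1); ...; (g_n, i_n)], with l_k the arity of g_k:      *)
(* p <= i_1 <= i_1 + l_1 <= i_2 <= ... <= i_n <= i_n + l_n <= u.               *)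
Fixpoint admissible (k : fieldType) (W U : gradedSpace k) (p u : nat)
    (gis : seq (hmap W U * nat)) : bool :=
  if gis is (g, i) :: r then (p <= i)%N && admissible (i + ar g) u r
  else (p <= u)%N.

(* The word a_(p+1,i_1), g_1(a_(i_1+1,i_1+l_1)), ..., a_(i_n+l_n+1,u). *)
Fixpoint insertion (k : fieldType) (W : gradedSpace k) (p : nat)
    (gis : seq (hmap W W * nat)) (w : seq W) : seq W :=
  if gis is (g, i) :: r then
    slice p i w ++ hfn g (slice i (i + ar g) w) :: insertion (i + ar g) r w
  else drop p w.

(* The sign (-1)^xi of a brace term, xi = sum_k |g_k| sum_(j <= i_k) |w_j|,    *)
(* regrouped letter by letter: w_j is multiplied by (-1)^(d_j |w_j|), where    *)
(* d_j is the sum of the |g_k| with j <= i_k (here positions j start at 0).    *)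
Definition brace_sign (k : fieldType) (W : gradedSpace k)
    (gis : seq (hmap W W * nat)) (w : seq W) : seq W :=
  [seq koszul (\sum_(gi <- gis | (j < gi.2)%N) dg gi.1) (nth 0 w j)
     | j <- iota 0 (size w)].

(* f{g_1, ..., g_n}, for f, g_i with values in W (= sV); the dg here are the   *)
(* degrees of sf and sg_i.                                                     *)
Definition brace_ar (k : fieldType) (W : gradedSpace k)
    (f : hmap W W) (gs : seq (hmap W W)) : nat :=
  (ar f + \sum_(g <- gs) ar g - size gs)%N.

Definition brace (k : fieldType) (W : gradedSpace k)
    (f : hmap W W) (gs : seq (hmap W W)) : hmap W W :=
  let u := brace_ar f gs in
  HMap u (dg f + \sum_(g <- gs) dg g)
    (fun w => if (size w == u) && (size gs <= ar f)%N then
        \sum_(i : (size gs).-tuple 'I_u.+1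
               | admissible 0 u (zip gs (map val i)))
          hfn f (insertion 0 (zip gs (map val i))
                  (brace_sign (zip gs (map val i)) w))
      else 0).

Definition gbracket (k : fieldType) (W : gradedSpace k) (f g : hmap W W) :
    seq W -> W :=
  fun w => hfn (brace f [:: g]) w
           - sgi k (dg f * dg g) *: hfn (brace g [:: f]) w.

(* The word of the values of g_1 (x) ... (x) g_n at w, with its Koszul sign    *)
(* (-1)^(sum_(i > j) |g_i||w_(j)|), w_(j) being the block of w fed to g_j.     *)
Fixpoint tensor_word (k : fieldType) (W U : gradedSpace k)
    (gs : seq (hmap W U)) (w : seq W) : seq U :=
  if gs is g :: r then
    hfn g (map (koszul (\sum_(g' <- r) dg g')) (take (ar g) w))
      :: tensor_word r (drop (ar g) w)
  else [::].

(* h o (g_1 (x) ... (x) g_n) *)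
Definition comp_tensor (k : fieldType) (W U : gradedSpace k)
    (h : hmap W U) (gs : seq (hmap W W)) : seq W -> U :=
  fun w => if size w == (\sum_(g <- gs) ar g)%N then hfn h (tensor_word gs w)
           else 0.

(* Koszul sign eps(sigma; x_1, ..., x_m), for x_i of degree d i: the factors   *)
(* exchanged by sigma are the inversions of sigma.                             *)
Definition koszul_sign (k : fieldType) (m : nat) (sigma : 'S_m)
    (d : 'I_m -> int) : k :=
  \prod_(i < m) \prod_(j < m | (i < j)%N && (sigma j < sigma i)%N)
     sgi k (d (sigma i) * d (sigma j)).

Definition chi (k : fieldType) (m : nat) (sigma : 'S_m) (d : 'I_m -> int) : k :=
  (-1) ^+ sigma * koszul_sign k sigma d.

Definition permute (A : Type) (gs : seq A) (sigma : 'S_(size gs)) : seq A :=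
  [seq tnth (in_tuple gs) (sigma i) | i <- enum 'I_(size gs)].

(* sum_(1 <= k <= m-1) sum_(1 <= j <= k) |g_j|, where m is the size of gs *)
Definition degree_sum (k : fieldType) (W U : gradedSpace k)
    (gs : seq (hmap W U)) : int :=
  \sum_(1 <= i < size gs) \sum_(g <- take i gs) dg g.

(* s^-1 (sg_1){sh{sg_2, ..., sg_m}}, where sh is written h *)
Definition nested (k : fieldType) (V : gradedSpace k)
    (h : hmap (susp V) (susp V)) (gs : seq (hmap (susp V) V)) : seq (susp V) -> V :=
  if gs is g :: r then
    fun w => sinv (hfn (brace (smap g) [:: brace h (map (@smap k _ V) r)]) w)
  else 0.

(* l_(m+1)(sh (x) g_1 (x) ... (x) g_m) for m >= 1. The argument h stands for   *)
(* the map sh, so |h| + 1 in the usual formulas is dg h.                       *)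
Definition l_mixed (k : fieldType) (V : gradedSpace k) (lambda : k)
    (h : hmap (susp V) (susp V)) (gs : seq (hmap (susp V) V)) :
    seq (susp V) -> V :=
  let n := ar h in let m := size gs in
  let c sigma := chi k sigma (fun i => dg (tnth (in_tuple gs) i)) in
  let d1 (gsig : seq (hmap (susp V) V)) := head 0 (map (@dg k _ V) gsig) + 1 in
  fun w =>
  if m == n then
    \sum_(sigma : 'S_m) let gsig := permute sigma in
      (c sigma * sgi k (n%:Z * dg h + degree_sum gsig)) *:
        (sinv (comp_tensor h (map (@smap k _ V) gsig) w)
         - sgi k (d1 gsig * dg h) *: nested h gsig w)
  else if (m < n)%N then
    \sum_(sigma : 'S_m) let gsig := permute sigma in
      (c sigma * sgi k (1 + m%:Z * dg h + degree_sum gsig + dg h * d1 gsig)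
         * lambda ^+ (n - m)) *: nested h gsig w
  else 0.

(* The underlying functions of elements of C_Alg(V) (+) C_RBO(V). *)
Definition cochain (k : fieldType) (V : gradedSpace k) : Type :=
  ((seq (susp V) -> susp V) * (seq (susp V) -> V))%type.

(* C_RBA(V)_r *)
Definition C_RBA (k : fieldType) (V : gradedSpace k) (r : int) :
    set (cochain V) :=
  HomT (susp V) (susp V) r `*` HomT (susp V) V r.
Arguments C_RBA {k} V r _.

(* A homogeneous element of fixed arity, of C_Alg(V) (inl) or C_RBO(V) (inr). *)
Definition hgen (k : fieldType) (V : gradedSpace k) : Type :=
  (hmap (susp V) (susp V) + hmap (susp V) V)%type.

Definition is_alg (k : fieldType) (V : gradedSpace k) (x : hgen V) : bool :=
  if x is inl _ then true else false.
Definition algs (k : fieldType) (V : gradedSpace k) (xs : seq (hgen V)) :=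
  pmap (fun x : hgen V => if x is inl h then Some h else None) xs.
Definition rbos (k : fieldType) (V : gradedSpace k) (xs : seq (hgen V)) :=
  pmap (fun x : hgen V => if x is inr g then Some g else None) xs.

(* l_n (n = size xs) on homogeneous elements of fixed arity. In the third      *)
(* case kk is the number of elements of C_RBO preceding the one of C_Alg.      *)
Definition l_hom (k : fieldType) (V : gradedSpace k) (lambda : k)
    (xs : seq (hgen V)) : cochain V :=
  match algs xs, rbos xs with
  | [:: h], [::] =>
      ((fun=> 0), if ar h == 0%N then fun w => sinv (hfn h w) else fun=> 0)
  | [:: f; h], [::] => (gbracket f h, fun=> 0)
  | [:: h], gs =>
      let kk := find (@is_alg k V) xs in
      ((fun=> 0), fun w =>
         sgi k (dg h * (\sum_(g <- take kk gs) dg g) + kk%:Z) *: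
           l_mixed lambda h gs w)
  | _, _ => ((fun=> 0), (fun=> 0))
  end.

Definition restrict_ar (k : fieldType) (W U : gradedSpace k) (n : nat)
    (f : seq W -> U) : seq W -> U := fun w => if size w == n then f w else 0.

(* The arity n component of the C_Alg part (b = true) or of the C_RBO part     *)
(* (b = false) of a cochain x of degree r.                                     *)
Definition component (k : fieldType) (V : gradedSpace k) (r : int)
    (x : cochain V) (b : bool) (n : nat) : hgen V :=
  if b then inl (HMap n r (restrict_ar n x.1))
  else inr (HMap n r (restrict_ar n x.2)).

(* The multilinear extension of l_hom to elements xs_i = (r_i, x_i), with x_i  *)
(* in C_RBA(V)_(r_i): a sum over all choices of one component in each x_i.     *)
(* Its value on words w only involves components of arity < size w + n,        *)
(* since the output of l_hom has arity > a - n if one input has arity a; so    *)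
(* the sum below runs over all the components which matter.                    *)
Definition l_op (k : fieldType) (V : gradedSpace k) (lambda : k)
    (xs : seq (int * cochain V)) : cochain V :=
  let n := size xs in
  let term B (t : n.-tuple (bool * 'I_B)) :=
    l_hom lambda [seq component x.1.1 x.1.2 x.2.1 x.2.2
                    | x : (int * cochain V) * (bool * 'I_B) <- zip xs t] in
  ((fun w => \sum_(t : n.-tuple (bool * 'I_(size w + n))) (term _ t).1 w),
   (fun w => \sum_(t : n.-tuple (bool * 'I_(size w + n))) (term _ t).2 w)).

(* (1/n!) (-1)^(n(n-1)/2) l_n(x, ..., x), for x of degree -1 *)
Definition MC_term (k : fieldType) (V : gradedSpace k) (lambda : k)
    (x : cochain V) (n : nat) : cochain V :=
  let l := l_op lambda (nseq n (-1, x)) in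
  let c : k := (n`!)%:R^-1 * (-1) ^+ (n * (n - 1))./2 in
  ((fun w => c *: l.1 w), (fun w => c *: l.2 w)).

(* Maurer-Cartan elements: all but finitely many terms vanish, and the sum of  *)
(* the others is 0.                                                            *)
Definition MC (k : fieldType) (V : gradedSpace k) (lambda : k) :
    set (cochain V) :=
  [set x | C_RBA V (-1) x /\
     exists N : nat,
       (forall n, (N < n)%N -> MC_term lambda x n = ((fun=> 0), (fun=> 0))) /\
       (forall w, \sum_(1 <= n < N.+1) (MC_term lambda x n).1 w = 0) /\
       (forall w, \sum_(1 <= n < N.+1) (MC_term lambda x n).2 w = 0)].
Arguments MC {k} V lambda _.

(* (V, mu, T) is a Rota-Baxter algebra of weight lambda; associative algebras  *)
(* are not required to have a unit.                                            *)
Definition rota_baxter (k : fieldType) (V : lmodType k) (lambda : k) :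
    set ((V -> V -> V) * (V -> V)) :=
  [set muT | let mu := muT.1 in let T := muT.2 in
     [/\ (forall a, linear (mu a)) /\ (forall b, linear (fun a => mu a b)),
         associative mu, linear T &
         forall a b, mu (T a) (T b) =
           T (mu a (T b) + mu (T a) b + lambda *: mu a b)]].
Arguments rota_baxter {k} V lambda _.

(* (m, tau) |-> (s^-1 o m o (s (x) s), tau o s); the Koszul sign of s (x) s    *)
(* is (-1)^(|s||a|) = 1, as V is concentrated in degree 0.                     *)
Definition of_cochain (k : fieldType) (V : lmodType k)
    (x : cochain (deg0 V)) : (V -> V -> V) * (V -> V) :=
  let s : V -> susp (deg0 V) := @s_ k (deg0 V) in
  ((fun a b => sinv (x.1 [:: s a; s b])), (fun a => x.2 [:: s a])).

(* Main.v *)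
Require Import Defs.
From mathcomp Require Import all_boot all_order all_algebra perm.
From mathcomp Require Import boolp classical_sets functions fsbigop.
Import GRing.Theory.
Local Open Scope classical_set_scope.
Local Open Scope ring_scope.
Set Implicit Arguments.
Unset Strict Implicit.
Unset Printing Implicit Defensive.

(** Since V sits in degree 0, all letters of words in sV have degree 1, and a map
    of degree -1 must send words of length n to degree n - 1. This is the degree of
    sV only for n = 2 and that of V only for n = 1. Hence a cochain of degree -1
    amounts to a binary product m on sV together with a linear operator tau from
    sV to V ([HomT_susp_deg0], [C_RBA_deg0]), and these correspond to
    pairs (mu, T) of a bilinear product and a linear operator on V.

    The Maurer-Cartan series of such a pair has at most two nonzero terms. An
    operation is nonzero only on two products, or on one product and some
    operators, at most two of them because the product is binary
    ([l_hom_slot_eq0]). So what remains is the following.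
    - l_2(m, m), the Gerstenhaber bracket, is twice m{m}, and m{m} is the
      associator of mu, its minus sign coming from m crossing a letter of degree 1
      ([gbracket_product]).
    - l_2(m, tau) is lambda T(mu(a, b)) ([l_mixed_operator1]).
    - l_3(m, tau, tau) compares mu(T a, T b) with T(mu(a, T b) + mu(T a, b)), each
      counted twice by the symmetrization ([l_mixed_operator2]).
    As m and tau have degree -1, Koszul signs compensate signatures, and all
    placements of m among the arguments contribute equally ([l_hom_slot_mixed]).
    The resulting multiplicities 2 and 6 cancel the factors 1/2! and 1/3!, which is
    where characteristic 0 enters, and the sign (-1)^(n(n-1)/2) is -1 in both terms.
    The algebra part of the equation is then associativity of mu, and the operator
    part is the Rota-Baxter identity of weight lambda ([MC_rota_baxter]).

    The operations on inhomogeneous cochains are sums over tuples of components.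
    As any operation vanishes when one of its arguments does ([l_hom_null]), the
    sums reduce to sums over words of booleans, each choosing m or tau
    ([sum_components]). *)

(** * Vanishing on zero arguments *)

Lemma multilinear_0 (k : fieldType) (W U : gradedSpace k) (f : seq W -> U) w :
  multilinear f -> 0 \in w -> f w = 0.
Proof.
move=> fl /splitPr[w1 w2].
(* Linearity at -1 reads f 0 = - f 0 + f 0. *)
have := fl w1 w2 (-1) 0 0.
by rewrite scaler0 addr0 scaleN1r addNr.
Qed.

Lemma multilinearZ (k : fieldType) (W U : gradedSpace k) (f : seq W -> U) w1 w2 c a :
  multilinear f -> f (w1 ++ c *: a :: w2) = c *: f (w1 ++ a :: w2).
Proof.
move=> fl; have := fl w1 w2 c a 0; rewrite addr0 => ->.
by rewrite [f (_ ++ 0 :: _)](multilinear_0 fl) ?addr0 // mem_cat mem_head orbT.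
Qed.

Definition null (k : fieldType) (W U : gradedSpace k) (h : hmap W U) : bool :=
  `[< forall w, hfn h w = 0 >].

(** Boolean, as is [null], so that both can be tested with [has] and [all] on
    lists of maps, whose type has no decidable equality. *)
Definition multilin (k : fieldType) (W U : gradedSpace k) (h : hmap W U) : bool :=
  `[< multilinear (hfn h) >].

Lemma has_null_smap (k : fieldType) (W V : gradedSpace k) (gs : seq (hmap W V)) :
  has (@null k W (susp V)) (map (@smap k W V) gs) = has (@null k W V) gs.
Proof. by rewrite has_map. Qed.

(** An inserted zero map contributes a zero letter; this is what makes the brace
    vanish by multilinearity of the outer map. *)
Lemma mem0_insertion (k : fieldType) (W : gradedSpace k)
    (gis : seq (hmap W W * nat)) p w :
  has (@null k W W) (unzip1 gis) -> 0 \in insertion p gis w.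
Proof.
elim: gis p => [|[g i] gis IH] p //= /orP[/asboolP g0|gis0].
  by rewrite g0 mem_cat mem_head orbT.
by rewrite mem_cat in_cons IH ?orbT.
Qed.

Lemma mem0_tensor_word (k : fieldType) (W U : gradedSpace k)
    (gs : seq (hmap W U)) w :
  has (@null k W U) gs -> 0 \in tensor_word gs w.
Proof.
elim: gs w => [|g gs IH] w //= /orP[/asboolP g0|gs0].
  by rewrite g0 mem_head.
by rewrite in_cons IH ?orbT.
Qed.

Lemma brace_null_left (k : fieldType) (W : gradedSpace k) (f : hmap W W) gs :
  null f -> null (brace f gs).
Proof.
move=> /asboolP f0; apply/asboolP => w /=.
by case: ifP => // _; apply: big1 => i _; rewrite f0.
Qed.

Lemma brace_null_right (k : fieldType) (W : gradedSpace k) (f : hmap W W) gs :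
  multilin f -> has (@null k W W) gs -> null (brace f gs).
Proof.
move=> /asboolP fl gs0; apply/asboolP => w /=.
case: ifP => // _; apply: big1 => i _.
apply: (multilinear_0 fl); apply: mem0_insertion.
by rewrite unzip1_zip // size_map size_tuple.
Qed.

(** Vanishing of an entry is insensitive to the order of the entries, hence to the
    shuffling in the symmetrized operations. *)
Lemma has_permute (A : Type) (P : pred A) (gs : seq A) (sigma : 'S_(size gs)) :
  has P (permute sigma) = has P gs.
Proof.
rewrite -[gs in RHS]/(tval (in_tuple gs)) has_map.
apply/hasP/has_tnthP => [[i _ Pi]|[i Pi]]; first by exists (sigma i).
by exists ((sigma^-1)%g i); rewrite ?mem_enum //= permKV.
Qed.

Lemma all_permute (A : Type) (P : pred A) (gs : seq A) (sigma : 'S_(size gs)) :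
  all P (permute sigma) = all P gs.
Proof.
by rewrite -[LHS]negbK -has_predC has_permute has_predC negbK.
Qed.

Lemma nested_null (k : fieldType) (V : gradedSpace k)
    (h : hmap (susp V) (susp V)) (gs : seq (hmap (susp V) V)) w :
  multilin h -> all (@multilin k (susp V) V) gs ->
  null h || has (@null k (susp V) V) gs -> nested h gs w = 0.
Proof.
case: gs => [|g gs] //= hl /andP[gl _] h0.
suff /asboolP: null (brace (smap g) [:: brace h (map (@smap k _ V) gs)]) by exact.
case/or3P: h0 => [h0|g0|gs0]; last 2 first.
- exact: brace_null_left.
- by apply: brace_null_right => //=; rewrite brace_null_right //= has_null_smap.
- by apply: brace_null_right => //=; rewrite brace_null_left.
Qed.

Lemma comp_tensor_null (k : fieldType) (W U : gradedSpace k)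
    (h : hmap W U) (gs : seq (hmap W W)) w :
  multilin h -> null h || has (@null k W W) gs -> comp_tensor h gs w = 0.
Proof.
move=> /asboolP hl h0; rewrite /comp_tensor; case: ifP => // _.
case/orP: h0 => [/asboolP h0|gs0]; first exact: h0.
exact/(multilinear_0 hl)/mem0_tensor_word.
Qed.

Lemma l_mixed_null (k : fieldType) (V : gradedSpace k) (lambda : k)
    (h : hmap (susp V) (susp V)) (gs : seq (hmap (susp V) V)) w :
  multilin h -> all (@multilin k (susp V) V) gs ->
  null h || has (@null k (susp V) V) gs -> l_mixed lambda h gs w = 0.
Proof.
move=> hl gsl h0.
rewrite /l_mixed; case: ifP => _.
  apply: big1 => sigma _; rewrite nested_null ?all_permute ?has_permute //.
  rewrite comp_tensor_null ?has_null_smap ?has_permute //.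
  by rewrite scaler0 subr0 scaler0.
case: ifP => // _; apply: big1 => sigma _.
by rewrite nested_null ?all_permute ?has_permute // scaler0.
Qed.

(** [P] is a family so that one predicate, such as [null] or [multilin], covers
    both summands of the complex. *)
Definition hgen_pred (k : fieldType) (V : gradedSpace k)
    (P : forall U : gradedSpace k, pred (hmap (susp V) U)) : pred (hgen V) :=
  fun x => match x with inl h => P (susp V) h | inr g => P V g end.

Lemma has_hgen (k : fieldType) (V : gradedSpace k)
    (P : forall U : gradedSpace k, pred (hmap (susp V) U)) (xs : seq (hgen V)) :
  has (hgen_pred P) xs = has (P (susp V)) (algs xs) || has (P V) (rbos xs).
Proof.
elim: xs => [|[h|g] xs IH] //=; rewrite IH; first by rewrite orbA.
by rewrite orbCA.
Qed.

Lemma all_hgen (k : fieldType) (V : gradedSpace k)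
    (P : forall U : gradedSpace k, pred (hmap (susp V) U)) (xs : seq (hgen V)) :
  all (hgen_pred P) xs = all (P (susp V)) (algs xs) && all (P V) (rbos xs).
Proof.
elim: xs => [|[h|g] xs IH] //=; rewrite IH; first by rewrite andbA.
by rewrite andbCA.
Qed.

Lemma gbracket_null (k : fieldType) (W : gradedSpace k) (f g : hmap W W) w :
  multilin f -> multilin g -> null f || null g -> gbracket f g w = 0.
Proof.
move=> fl gl fg0.
have /asboolP fg : null (brace f [:: g]).
  case/orP: fg0 => [f0|g0]; first exact: brace_null_left.
  by apply: brace_null_right => //=; rewrite g0.
have /asboolP gf : null (brace g [:: f]).
  case/orP: fg0 => [f0|g0]; last exact: brace_null_left.
  by apply: brace_null_right => //=; rewrite f0.
by rewrite /gbracket fg gf scaler0 subr0.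
Qed.

(** The multilinear extension ranges over all components of a cochain, while a
    cochain of degree -1 on an ungraded space has at most two nonzero ones; this
    lemma discards all the others at once. *)
Lemma l_hom_null (k : fieldType) (V : gradedSpace k) (lambda : k)
    (xs : seq (hgen V)) :
  all (hgen_pred (@multilin k (susp V))) xs ->
  has (hgen_pred (@null k (susp V))) xs ->
  l_hom lambda xs = ((fun=> 0), (fun=> 0)).
Proof.
rewrite all_hgen has_hgen /l_hom => /andP[].
case: (algs xs) => [|h [|h' [|? ?]]] //=; case: (rbos xs) => [|g gs] //=.
- rewrite andbT orbF orbF => hl _ /asboolP h0; congr pair.
  by case: ifP => // _; apply/funext => w; rewrite h0.
- rewrite andbT orbF => hl gsl h0; congr pair; apply/funext => w.
  by rewrite l_mixed_null // scaler0.
- move=> /andP[hl /andP[hl' _]] _; rewrite !orbF => h0.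
  by congr pair; apply/funext => w; exact: gbracket_null.
Qed.

(** * Sums over tuples *)

Lemma sum_tuple0 (T : finType) (M : nmodType) (F : seq T -> M) :
  \sum_(t : 0.-tuple T) F t = F [::].
Proof.
rewrite (eq_bigr (fun=> F [::])) => [|t _]; last by rewrite tuple0.
by rewrite sumr_const card_tuple expn0.
Qed.

Lemma sum_tupleS (T : finType) (M : nmodType) n (F : seq T -> M) :
  \sum_(t : n.+1.-tuple T) F t =
  \sum_(x : T) \sum_(t : n.-tuple T) F (x :: t).
Proof.
rewrite pair_big /= (reindex (fun xt : T * n.-tuple T => [tuple of xt.1 :: xt.2])) //.
exists (fun t : n.+1.-tuple T => (thead t, [tuple of behead t])) => [[x t] _|t _] /=.
  by congr pair; apply/val_inj.
by rewrite [t]tuple_eta; apply/val_inj.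
Qed.

(** Induction on the length: the letters outside the image of [g] are summed away
    one position at a time. *)
Lemma sum_tuple_codom (S T : finType) (M : nmodType) (g : T -> S) n
    (F : seq S -> M) :
  injective g ->
  (forall s, has (fun x => x \notin codom g) s -> F s = 0) ->
  \sum_(t : n.-tuple S) F t = \sum_(t : n.-tuple T) F (map g t).
Proof.
move=> gI; elim: n F => [|n IH] F F0.
  by rewrite sum_tuple0 (sum_tuple0 (F \o map g)).
rewrite sum_tupleS (sum_tupleS _ (F \o map g)) /=.
have G0 x s : has (fun x => x \notin codom g) s -> F (x :: s) = 0.
  by move=> s0; apply: F0; rewrite /= s0 orbT.
under eq_bigr => x _ do rewrite (IH (fun s => F (x :: s)) (G0 x)).
rewrite (bigID (mem (codom g))) /= [X in _ + X]big1 ?addr0; last first.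
  by move=> x xg; apply: big1 => t _; apply: F0; rewrite /= xg.
rewrite -big_uniq ?big_image //=.
by rewrite map_inj_uniq ?enum_uniq.
Qed.

Lemma sum_bool_tuple1 (M : nmodType) (F : seq bool -> M) :
  \sum_(t : 1.-tuple bool) F t = F [:: true] + F [:: false].
Proof. by rewrite sum_tupleS big_bool !(sum_tuple0 (fun s => F (_ :: s))). Qed.

Lemma sum_bool_tuple2 (M : nmodType) (G : seq bool -> M) :
  \sum_(t : 2.-tuple bool) G t =
  G [:: true; true] + G [:: true; false] + (G [:: false; true] + G [:: false; false]).
Proof.
by rewrite (sum_tupleS 1 G) big_bool 2!(sum_bool_tuple1 (fun s => G (_ :: s))).
Qed.

Lemma sum_bool_tuple3 (M : nmodType) (G : seq bool -> M) :
  \sum_(t : 3.-tuple bool) G t =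
  \sum_(b : bool)
    (G [:: b; true; true] + G [:: b; true; false] +
     (G [:: b; false; true] + G [:: b; false; false])).
Proof.
rewrite (sum_tupleS 2 G); apply: eq_bigr => b _.
by rewrite (sum_bool_tuple2 (fun s => G (b :: s))).
Qed.

(** * Cochains on a space concentrated in degree 0 *)

(** Every vector of the suspension has degree 1. *)
Lemma koszul_susp_deg0 (k : fieldType) (V : lmodType k) (d : int)
    (a : susp (deg0 V)) : koszul d a = sgi k d *: a.
Proof.
rewrite /koszul -(@fsbig_widen _ _ _ _ [set 1]) //.
  by rewrite fsbig_set1 mulr1.
by move=> p [_ /= p1]; rewrite subr_eq0; case: eqP => // _; rewrite scaler0.
Qed.

(** The zero vector is homogeneous of every degree, hence the disjunction. *)
Lemma homog_susp_deg0 (k : fieldType) (V : lmodType k) (p : int)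
    (a : susp (deg0 V)) : homog p a = (p == 1) || (a == 0).
Proof.
by rewrite /homog /= subr_eq0; case: (p == 1); rewrite ?eqxx // eq_sym.
Qed.

Lemma homog_deg0 (k : fieldType) (V : lmodType k) (p : int)
    (a : deg0 V) : homog p a = (p == 0) || (a == 0).
Proof. by rewrite /homog /=; case: (p == 0); rewrite ?eqxx // eq_sym. Qed.

(** A word of n letters of degree 1 has degree n, so a map of degree r can be
    nonzero only on words whose length is shifted by r into the degree in which
    [U] lives. *)
Lemma HomT_susp_deg0 (k : fieldType) (V : lmodType k) (U : gradedSpace k) n r :
  (forall p (a : U), homog p a = (p == n%:Z + r) || (a == 0)) ->
  HomT (susp (deg0 V)) U r = Hom_ar (susp (deg0 V)) U n.
Proof.
move=> homU; have sum1 (pw : seq (int * V)) :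
    all (fun x => x.1 == 1) pw -> \sum_(x <- pw) x.1 = (size pw)%:Z.
  elim: pw => [|x pw IH] /=; first by rewrite big_nil.
  by move=> /andP[/eqP x1 /IH pwE]; rewrite big_cons pwE x1 intS.
apply/seteqP; split=> f [fl fh]; split=> //.
  move=> w wn; have := fh [seq (1, a) | a <- w].
  rewrite sum1 ?size_map; last by apply/allP => _ /mapP[a _ ->].
  rewrite -map_comp map_id homU (inj_eq (addIr _)) eqz_nat (negPf wn).
  move=> fw; apply/eqP/fw.
  by apply/allP => _ /mapP[a _ ->]; rewrite homog_susp_deg0.
move=> pw /allP pwh; rewrite homU; set w := map _ pw.
have [w0|w0] := boolP (0 \in w).
  by rewrite (multilinear_0 fl) // eqxx orbT.
rewrite sum1; last first.
  apply/allP => x xpw; have := pwh x xpw; rewrite homog_susp_deg0.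
  by case/orP => // /eqP x0; case/negP: w0; rewrite -x0; exact: map_f.
rewrite (inj_eq (addIr _)) eqz_nat -(size_map snd pw).
by have [//|/fh->] := eqVneq (size w) n; rewrite eqxx.
Qed.

Lemma C_RBA_deg0 (k : fieldType) (V : lmodType k) :
  C_RBA (deg0 V) (-1) =
    Hom_ar (susp (deg0 V)) (susp (deg0 V)) 2 `*` Hom_ar (susp (deg0 V)) (deg0 V) 1.
Proof.
rewrite /C_RBA (@HomT_susp_deg0 _ _ _ 2) ?(@HomT_susp_deg0 _ _ _ 1) //.
  exact: homog_deg0.
exact: homog_susp_deg0.
Qed.

(** * Braces with at most one argument *)

Lemma brace_nil (k : fieldType) (V : lmodType k)
    (f : hmap (susp (deg0 V)) (susp (deg0 V))) w :
  hfn (brace f [::]) w = if size w == ar f then hfn f w else 0.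
Proof.
rewrite /= /brace_ar /= big_nil addn0 subn0 andbT; case: ifP => // _.
rewrite big_mkcond /=.
pose gis (s : seq 'I_(ar f).+1) :=
  zip ([::] : seq (hmap (susp (deg0 V)) (susp (deg0 V)))) (map val s).
pose F s := if admissible 0 (ar f) (gis s)
  then hfn f (insertion 0 (gis s) (brace_sign (gis s) w)) else 0.
transitivity (F [::]); first exact: sum_tuple0.
rewrite /F /= drop0; congr (hfn f _); rewrite -[RHS](mkseq_nth 0 w).
by apply: eq_map => j; rewrite koszul_susp_deg0 big_nil scale1r.
Qed.

Lemma brace_sign_one (k : fieldType) (V : lmodType k)
    (g : hmap (susp (deg0 V)) (susp (deg0 V))) i w : (i <= size w)%N ->
  brace_sign [:: (g, i)] w = map (fun a => sgi k (dg g) *: a) (take i w) ++ drop i w.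
Proof.
move=> iw; apply: (@eq_from_nth _ 0) => [|j].
  by rewrite size_map size_iota size_cat size_map size_drop size_takel // subnKC.
rewrite size_map size_iota => jw.
rewrite (nth_map 0%N) ?size_iota // nth_iota // koszul_susp_deg0 big_mkcond big_seq1.
rewrite nth_cat size_map size_takel //=; case: ifP => ij.
  by rewrite (nth_map 0) ?size_takel // nth_take.
by rewrite nth_drop subnKC ?scale1r // leqNgt ij.
Qed.

(** The sign of inserting [g] after i letters of degree 1 is (-1)^(i|g|),
    distributed here over these i letters. *)
Lemma brace_one (k : fieldType) (V : lmodType k)
    (f g : hmap (susp (deg0 V)) (susp (deg0 V))) w (u := (ar f + ar g - 1)%N) :
  hfn (brace f [:: g]) w =
  if (size w == u) && (0 < ar f)%N then
    \sum_(i < u.+1 | (i + ar g <= u)%N)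
      hfn f (map (fun a => sgi k (dg g) *: a) (take i w)
             ++ hfn g (take (ar g) (drop i w)) :: drop (i + ar g) w)
  else 0.
Proof.
rewrite /= /brace_ar /= big_seq1 -/u; case: ifP => // /andP[/eqP wu _].
rewrite big_mkcond.
pose gis (s : seq 'I_u.+1) := zip [:: g] (map val s).
pose F s := if admissible 0 u (gis s)
  then hfn f (insertion 0 (gis s) (brace_sign (gis s) w)) else 0.
transitivity (\sum_(i < u.+1) F [:: i]).
  rewrite -[LHS]/(\sum_(t : 1.-tuple 'I_u.+1) F t) sum_tupleS.
  by apply: eq_bigr => i _; rewrite (sum_tuple0 (fun s => F (i :: s))).
rewrite [RHS]big_mkcond; apply: eq_bigr => i _; rewrite /F /=.
case: ifP => // iu.
have iw : (i <= size w)%N by rewrite wu (leq_trans _ iu) ?leq_addr.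
rewrite brace_sign_one // /slice subn0 drop0 addKn.
set w1 := map _ _.
have sw1 : size w1 = i by rewrite size_map size_takel.
rewrite take_cat drop_cat sw1 ltnn subnn take0 cats0 drop0.
by rewrite addnC -drop_drop drop_size_cat // drop_drop.
Qed.

(** * The operations on a product and an operator *)

Definition product_map (k : fieldType) (V : lmodType k) (x : cochain (deg0 V)) :
  hmap (susp (deg0 V)) (susp (deg0 V)) := HMap 2 (-1) x.1.

Definition operator_map (k : fieldType) (V : lmodType k) (x : cochain (deg0 V)) :
  hmap (susp (deg0 V)) (deg0 V) := HMap 1 (-1) x.2.

Lemma sgiN1 (k : fieldType) : sgi k (-1) = -1.
Proof. by rewrite /sgi exprN1 invrN1. Qed.

(** The product has degree -1, so its bracket with itself is twice its brace with
    itself. Inserting it in second position crosses one letter of degree 1, which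
    turns the sum of the two bracketings into the associator. *)
Lemma gbracket_product (k : fieldType) (V : lmodType k) (x : cochain (deg0 V)) w
  (mu := (of_cochain x).1) :
  C_RBA (deg0 V) (-1) x ->
  gbracket (product_map x) (product_map x) w =
  if w is [:: a; b; c] then (mu (mu a b) c - mu a (mu b c)) *+ 2 else 0.
Proof.
rewrite C_RBA_deg0 => -[[ml _] _].
have -> : gbracket (product_map x) (product_map x) w =
    hfn (brace (product_map x) [:: product_map x]) w *+ 2.
  by rewrite /gbracket /sgi /= expr1z scaleN1r opprK.
case: w => [|a [|b [|c [|d w]]]]; rewrite brace_one //= ?mul0rn //.
congr (_ *+ 2); rewrite big_mkcond !big_ord_recl big_ord0 /=.
rewrite !addr0 /= sgiN1.
have := multilinearZ [::] [:: x.1 [:: b; c]] (-1) a ml; rewrite /= => ->.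
by rewrite scaleN1r.
Qed.

Lemma nested_operator1 (k : fieldType) (V : lmodType k) (x : cochain (deg0 V)) w
  (mu := (of_cochain x).1) (T := (of_cochain x).2) :
  nested (product_map x) [:: operator_map x] w =
  if w is [:: a; b] then T (mu a b) else 0.
Proof.
rewrite /nested [map _ [::]]/=.
set h := brace (product_map x) _; have hE : ar h = 2%N by rewrite /= /brace_ar big_nil.
have hfnE w' : hfn h w' = _ := brace_nil _ w'.
rewrite brace_one; move: h hE hfnE => h -> hfnE.
case: w => [|a [|b [|c w]]] //=; rewrite big_mkcond !big_ord_recl big_ord0 /= !addr0.
by rewrite hfnE.
Qed.

(** The suspended operator has degree 0, so that both insertions into the product
    occur with sign +1. *)
Lemma nested_operator2 (k : fieldType) (V : lmodType k) (x : cochain (deg0 V)) w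
  (mu := (of_cochain x).1) (T := (of_cochain x).2) :
  nested (product_map x) [:: operator_map x; operator_map x] w =
  if w is [:: a; b] then T (mu a (T b) + mu (T a) b) else 0.
Proof.
rewrite /nested [map _ [:: _]]/=.
set h := brace (product_map x) _; have hE : ar h = 2%N by rewrite /= /brace_ar big_seq1.
have hfnE w' : hfn h w' = _ := brace_one _ _ w'.
rewrite brace_one; move: h hE hfnE => h -> hfnE.
case: w => [|a [|b [|c w]]] //=; rewrite big_mkcond !big_ord_recl big_ord0 /= !addr0.
rewrite hfnE /= big_mkcond !big_ord_recl big_ord0 /= !addr0.
by rewrite /sgi expr0z scale1r addrC.
Qed.

Lemma comp_tensor_operator2 (k : fieldType) (V : lmodType k) (x : cochain (deg0 V)) w
  (mu := (of_cochain x).1) (T := (of_cochain x).2) :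
  comp_tensor (product_map x)
    (map (@smap _ _ _) [:: operator_map x; operator_map x]) w =
  if w is [:: a; b] then mu (T a) (T b) else 0.
Proof.
rewrite /comp_tensor !big_cons big_nil.
case: w => [|a [|b [|c w]]] //=.
by rewrite !koszul_susp_deg0 big_seq1 big_nil !scale1r.
Qed.

Lemma permute_nseq (A : Type) (m : nat) (g : A) (sigma : 'S_(size (nseq m g))) :
  permute sigma = nseq m g.
Proof.
have gE i : tnth (in_tuple (nseq m g)) i = g.
  by rewrite (tnth_nth g) nth_nseq if_same.
rewrite /permute; under eq_map => i do rewrite gE.
transitivity (nseq (size (enum 'I_(size (nseq m g)))) g).
  by elim: (enum _) => //= i s ->.
by rewrite -cardE card_ord size_nseq.
Qed.

Lemma perm_S2 (sigma : 'S_2) : sigma = 1%g \/ sigma = tperm ord0 ord_max.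
Proof.
have ord2 (i : 'I_2) : i = ord0 \/ i = ord_max.
  by case: i => [[|[|i]] ilt] //; [left|right]; apply/val_inj.
have : sigma ord0 != sigma ord_max by rewrite (inj_eq perm_inj).
case: (ord2 (sigma ord0)) => s0; case: (ord2 (sigma ord_max)) => s1;
  rewrite s0 s1 ?eqxx // => _; [left|right]; apply/permP => i;
  by case: (ord2 i) => ->; rewrite ?perm1 ?tpermL ?tpermR.
Qed.

Lemma chi_S1 (k : fieldType) (sigma : 'S_1) (d : 'I_1 -> int) :
  chi k sigma d = 1.
Proof.
have -> : sigma = 1%g by apply/permP => i; rewrite !ord1.
rewrite /chi odd_perm1 /koszul_sign.
by rewrite big1 ?mulr1 // => i _; apply: big1 => j; rewrite !ord1.
Qed.

(** The Koszul sign of exchanging two elements of odd degree cancels the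
    signature; hence the sum over permutations repeats the same term. *)
Lemma chi_S2_odd (k : fieldType) (sigma : 'S_2) (d : 'I_2 -> int) :
  (forall i, d i = -1) -> chi k sigma d = 1.
Proof.
move=> d1; rewrite /chi /koszul_sign.
under eq_bigr => i _ do rewrite big_mkcond.
rewrite !big_ord_recl !big_ord0 !d1.
case: (perm_S2 sigma) => ->.
  by rewrite odd_perm1 !perm1 /= !mulr1.
have -> : lift ord0 ord0 = ord_max :> 'I_2 by apply/val_inj.
rewrite odd_tperm tpermL tpermR /= (_ : -1 * -1 = 1) // /sgi expr1z.
by rewrite !(mulr1, mul1r) mulrNN mulr1.
Qed.

(** With |sh| = -1 for the product and |g| = -1 for the operator, the sign exponent
    1 + |sh| + |sh|(|g| + 1) is 0. *)
Lemma l_mixed_operator1 (k : fieldType) (V : lmodType k) (lambda : k)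
    (x : cochain (deg0 V)) w
    (mu := (of_cochain x).1) (T := (of_cochain x).2) :
  l_mixed lambda (product_map x) [:: operator_map x] w =
  if w is [:: a; b] then lambda *: T (mu a b) else 0.
Proof.
rewrite /l_mixed /=.
rewrite (eq_bigr (fun=> lambda *: nested (product_map x) [:: operator_map x] w)).
  rewrite sumr_const (_ : #|_| = 1%N) ?card_Sn // nested_operator1 //.
  by case: w => [|a [|b [|c w]]]; rewrite ?scaler0.
move=> sigma _; rewrite (@permute_nseq _ 1) chi_S1 /=.
by rewrite /degree_sum big_geq // !mul1r.
Qed.

(** The overall sign exponent is 2(-1) + (-1), which is odd, whereas the nested
    brace is subtracted with sign +1, as the suspended operator has degree 0. *)
Lemma l_mixed_operator2 (k : fieldType) (V : lmodType k) (lambda : k)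
    (x : cochain (deg0 V)) w
    (mu := (of_cochain x).1) (T := (of_cochain x).2) :
  l_mixed lambda (product_map x) [:: operator_map x; operator_map x] w =
  if w is [:: a; b] then
    (T (mu a (T b) + mu (T a) b) - mu (T a) (T b)) *+ 2
  else 0.
Proof.
rewrite /l_mixed /=.
pose gs := [:: operator_map x; operator_map x].
rewrite (eq_bigr (fun=> nested (product_map x) gs w
  - sinv (comp_tensor (product_map x) (map (@smap _ _ _) gs) w))).
  rewrite sumr_const (_ : #|_| = 2%N) ?card_Sn // nested_operator2 //.
  rewrite comp_tensor_operator2 //.
  by case: w => [|a [|b [|c w]]]; rewrite ?subr0 ?mul0rn.
move=> sigma _; rewrite (@permute_nseq _ 2) chi_S2_odd; last first.
  by move=> i; rewrite (tnth_nth (operator_map x)); case: i => [[|[|]]].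
have signE : sgi k (2%:Z * -1 + -1) = -1.
  by rewrite /sgi (_ : _ + _ = Negz 2) // /exprz -signr_odd expr1 invrN1.
rewrite /degree_sum big_nat1 big_seq1 mul1r [X in X *: _]signE.
by rewrite scaleN1r (_ : sgi k _ = 1) ?scale1r ?opprB.
Qed.

(** The only components of a cochain of degree -1 that can be nonzero: [true] stands
    for the algebra part, [false] for the operator part. *)
Definition slot (k : fieldType) (V : lmodType k) (x : cochain (deg0 V)) (b : bool) :
  hgen (deg0 V) := if b then inl (product_map x) else inr (operator_map x).

Lemma algs_slot (k : fieldType) (V : lmodType k) (x : cochain (deg0 V)) bs :
  algs (map (slot x) bs) = nseq (count id bs) (product_map x).
Proof. by elim: bs => [|[] bs IH] //=; rewrite IH. Qed.

Lemma rbos_slot (k : fieldType) (V : lmodType k) (x : cochain (deg0 V)) bs :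
  rbos (map (slot x) bs) = nseq (count negb bs) (operator_map x).
Proof. by elim: bs => [|[] bs IH] //=; rewrite IH. Qed.

(** Only two products, or one product with one or two operators, give a nonzero
    operation: the product has arity 2, so it accepts at most two operators. The
    values live on words of length 2 or 3, which rules out the short words
    of the first alternative. *)
Lemma l_hom_slot_eq0 (k : fieldType) (V : lmodType k) (lambda : k)
    (x : cochain (deg0 V)) bs w :
  C_RBA (deg0 V) (-1) x -> (size bs + size w <= 2)%N || (3 < size bs)%N ->
  (l_hom lambda (map (slot x) bs)).1 w = 0 /\
  (l_hom lambda (map (slot x) bs)).2 w = 0.
Proof.
move=> xC; have -> : size bs = (count id bs + count negb bs)%N.
  by rewrite -(count_predC id bs).
rewrite /l_hom algs_slot rbos_slot.
case: (count id bs) => [|[|[|p]]] //=; case: (count negb bs) => [|[|[|q]]] //=.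
- by rewrite l_mixed_operator1; case: w => [|a [|b w]] //=; rewrite scaler0.
- by rewrite /l_mixed /= scaler0.
- by rewrite gbracket_product //; case: w.
Qed.

(** * Collapsing the sum over components *)

Lemma multilinear_restrict (k : fieldType) (W U : gradedSpace k) n (f : seq W -> U) :
  multilinear f -> multilinear (restrict_ar n f).
Proof.
move=> fl w1 w2 c a b; rewrite /restrict_ar !size_cat /=.
by case: ifP => _; [exact: fl|rewrite scaler0 addr0].
Qed.

Lemma restrict_ar_id (k : fieldType) (W U : gradedSpace k) n (f : seq W -> U) :
  Hom_ar W U n f -> restrict_ar n f = f.
Proof.
move=> [_ f0]; apply/funext => w; rewrite /restrict_ar.
by case: eqP => // /eqP/f0->.
Qed.

Lemma component_slot (k : fieldType) (V : lmodType k) (x : cochain (deg0 V)) b :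
  C_RBA (deg0 V) (-1) x -> component (-1) x b (if b then 2 else 1)%N = slot x b.
Proof.
by rewrite C_RBA_deg0 => -[x1 x2]; case: b; rewrite /component restrict_ar_id.
Qed.

Lemma component_null (k : fieldType) (V : lmodType k) (x : cochain (deg0 V)) b n :
  C_RBA (deg0 V) (-1) x -> n != (if b then 2 else 1)%N ->
  hgen_pred (@null k (susp (deg0 V))) (component (-1) x b n).
Proof.
rewrite C_RBA_deg0 => -[[_ x1] [_ x2]] nb.
by case: b nb => nb; apply/asboolP => w /=; rewrite /restrict_ar; case: eqP => // wn;
  rewrite ?x1 ?x2 ?wn.
Qed.

Lemma component_multilin (k : fieldType) (V : lmodType k) (x : cochain (deg0 V)) b n :
  C_RBA (deg0 V) (-1) x ->
  hgen_pred (@multilin k (susp (deg0 V))) (component (-1) x b n).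
Proof.
rewrite C_RBA_deg0 => -[[x1 _] [x2 _]].
by case: b; apply/asboolP; exact: multilinear_restrict.
Qed.

(** The bound [B] on the arities may be too small to contain the arity 2 of the
    product; [Fsmall] says that in this case the right-hand side vanishes too. *)
Lemma sum_components (k : fieldType) (V : lmodType k) (lambda : k)
    (x : cochain (deg0 V)) (M : nmodType) (F : cochain (deg0 V) -> M) n B :
  C_RBA (deg0 V) (-1) x -> F ((fun=> 0), (fun=> 0)) = 0 ->
  ((B <= 2)%N -> forall bs, size bs = n -> F (l_hom lambda (map (slot x) bs)) = 0) ->
  \sum_(t : n.-tuple (bool * 'I_B))
    F (l_hom lambda [seq component (-1) x bi.1 bi.2 | bi : bool * 'I_B <- t]) =
  \sum_(bs : n.-tuple bool) F (l_hom lambda (map (slot x) bs)).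
Proof.
move=> xC F0 Fsmall.
have multE (s : seq (bool * 'I_B)) :
    all (hgen_pred (@multilin k (susp (deg0 V))))
        [seq component (-1) x bi.1 bi.2 | bi : bool * 'I_B <- s].
  by rewrite all_map; apply/allP => bi _; exact: component_multilin.
have nullE (s : seq (bool * 'I_B)) (bi : bool * 'I_B) : bi \in s ->
    val bi.2 != (if bi.1 then 2 else 1)%N ->
    F (l_hom lambda [seq component (-1) x bi.1 bi.2 | bi : bool * 'I_B <- s]) = 0.
  move=> bis bi2; rewrite l_hom_null // has_map; apply/hasP; exists bi => //.
  exact: component_null.
have [B2|B2] := leqP B 2.
  rewrite [RHS]big1 => [|bs _]; last by rewrite Fsmall ?size_tuple.
  apply: big1 => t _.
  have [/allP tS|/allPn[bi bit bi2]] :=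
    boolP (all (fun bi => val bi.2 == (if bi.1 then 2 else 1)%N) t); last first.
    exact: (nullE _ bi).
  rewrite (_ : map _ _ = map (slot x) (map fst t)).
    by rewrite Fsmall ?size_map ?size_tuple.
  rewrite -map_comp; apply/eq_in_map => bi /tS /eqP bi2 /=.
  by rewrite -component_slot // -bi2.
pose g (b : bool) : bool * 'I_B :=
  (b, if b then Ordinal B2 else Ordinal (ltnW B2)).
have gI : injective g by move=> b b' [].
rewrite (sum_tuple_codom (F := fun s : seq (bool * 'I_B) =>
   F (l_hom lambda [seq component (-1) x bi.1 bi.2 | bi : bool * 'I_B <- s])) _ gI).
  apply: eq_bigr => bs _; rewrite -map_comp; congr (F (l_hom lambda _)).
  by apply: eq_map => b /=; rewrite -component_slot //; case: b.
move=> s /hasP[bi bis big]; apply: (nullE _ bi) => //.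
apply: contra big => /eqP bi2; apply/codomP; exists bi.1.
by case: bi bi2 {bis} => [[] i] /= bi2; congr pair; exact: val_inj.
Qed.

Lemma l_op_tuples (k : fieldType) (V : lmodType k) (lambda : k)
    (x : cochain (deg0 V)) n w :
  C_RBA (deg0 V) (-1) x ->
  (l_op lambda (nseq n (-1, x))).1 w =
    \sum_(bs : n.-tuple bool) (l_hom lambda (map (slot x) bs)).1 w /\
  (l_op lambda (nseq n (-1, x))).2 w =
    \sum_(bs : n.-tuple bool) (l_hom lambda (map (slot x) bs)).2 w.
Proof.
move=> xC; rewrite /l_op size_nseq /=.
have zipE B (s : seq (bool * 'I_B)) : size s = n ->
    [seq component y.1.1 y.1.2 y.2.1 y.2.2
       | y : (int * cochain (deg0 V)) * (bool * 'I_B) <- zip (nseq n (-1, x)) s] =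
    [seq component (-1) x bi.1 bi.2 | bi : bool * 'I_B <- s].
  by elim: s n => [|bi s IH] [|n] //= [/IH->].
split.
  rewrite -(sum_components (F := fun y => y.1 w) (B := size w + n) xC) //.
    by apply: eq_bigr => t _; rewrite zipE ?size_tuple.
  move=> B2 bs bsn; apply: (l_hom_slot_eq0 _ _ _).1 => //.
  by rewrite bsn addnC B2.
rewrite -(sum_components (F := fun y => y.2 w) (B := size w + n) xC) //.
  by apply: eq_bigr => t _; rewrite zipE ?size_tuple.
move=> B2 bs bsn; apply: (l_hom_slot_eq0 _ _ _).2 => //.
by rewrite bsn addnC B2.
Qed.

(** Moving the product past p operators of degree -1 produces the sign
    (-1)^(p + p), so the position of the product is irrelevant. *)
Lemma l_hom_slot_mixed (k : fieldType) (V : lmodType k) (lambda : k)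
    (x : cochain (deg0 V)) p q w : (0 < p + q)%N ->
  (l_hom lambda (map (slot x) (nseq p false ++ true :: nseq q false))).2 w =
  l_mixed lambda (product_map x) (nseq (p + q) (operator_map x)) w.
Proof.
move=> pq0; rewrite /l_hom algs_slot rbos_slot.
have -> : count id (nseq p false ++ true :: nseq q false) = 1%N.
  by rewrite count_cat /= !count_nseq /= !mul0n.
have -> : count negb (nseq p false ++ true :: nseq q false) = (p + q)%N.
  by rewrite count_cat /= !count_nseq /= !mul1n.
have -> : find (@is_alg k (deg0 V))
    (map (slot x) (nseq p false ++ true :: nseq q false)) = p.
  by elim: p {pq0} => //= p ->.
have takeE : take p (nseq (p + q) (operator_map x)) = nseq p (operator_map x).
  by rewrite nseqD take_size_cat ?size_nseq.
have sum_dg : \sum_(g <- nseq p (operator_map x)) dg g = - p%:Z.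
  by rewrite big_nseq iter_addr_0 mulNrn natz.
move: pq0 takeE; case: (p + q)%N => // r _ /= ->; rewrite sum_dg mulrNN mul1r.
by rewrite /sgi -PoszD addnn -exprnP -signr_odd odd_double scale1r.
Qed.

(** * The terms of the Maurer-Cartan series *)

Lemma scale_invn_mulrn (k : fieldType) (V : lmodType k) n (a : V) :
  [pchar k] =i pred0 -> (0 < n)%N -> n%:R^-1 *: (a *+ n) = a.
Proof.
move=> /pcharf0P char0 n0; rewrite -scaler_nat scalerA mulVf ?scale1r //.
by rewrite char0 -lt0n.
Qed.

Lemma MC_term_tuples (k : fieldType) (V : lmodType k) (lambda : k)
    (x : cochain (deg0 V)) n
    (c := n`!%:R^-1 * (-1) ^+ (n * (n - 1))./2 : k) :
  C_RBA (deg0 V) (-1) x ->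
  MC_term lambda x n =
  ((fun w => c *: \sum_(bs : n.-tuple bool) (l_hom lambda (map (slot x) bs)).1 w),
   (fun w => c *: \sum_(bs : n.-tuple bool) (l_hom lambda (map (slot x) bs)).2 w)).
Proof.
move=> xC; rewrite /MC_term; congr pair; apply/funext => w.
  by rewrite (l_op_tuples lambda n w xC).1.
by rewrite (l_op_tuples lambda n w xC).2.
Qed.

(** The unary operation sees only components of arity 0 in the algebra part, and
    four or more arguments exceed what a binary product accepts. *)
Lemma MC_term_eq0 (k : fieldType) (V : lmodType k) (lambda : k)
    (x : cochain (deg0 V)) n :
  C_RBA (deg0 V) (-1) x -> (0 < n)%N -> n != 2%N -> n != 3%N ->
  MC_term lambda x n = ((fun=> 0), (fun=> 0)).
Proof.
move=> xC n0 n2 n3.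
have bs0 (bs : seq bool) w : size bs = n ->
    (l_hom lambda (map (slot x) bs)).1 w = 0 /\
    (l_hom lambda (map (slot x) bs)).2 w = 0.
  case: n n0 n2 n3 => [|[|[|[|n]]]] // _ _ _ bsn.
    by case: bs bsn => [|[] [|]].
  by apply: l_hom_slot_eq0; rewrite ?bsn ?orbT.
rewrite MC_term_tuples //; congr pair; apply/funext => w.
  rewrite big1 ?scaler0 // => bs _.
  by have [] := bs0 bs w (size_tuple bs).
rewrite big1 ?scaler0 // => bs _.
by have [] := bs0 bs w (size_tuple bs).
Qed.

(** The factor 1/2! cancels the two equal halves of the bracket. *)
Lemma MC_term2_product (k : fieldType) (V : lmodType k) (lambda : k)
    (x : cochain (deg0 V)) w (mu := (of_cochain x).1) :
  [pchar k] =i pred0 -> C_RBA (deg0 V) (-1) x ->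
  (MC_term lambda x 2).1 w =
  if w is [:: a; b; c] then mu a (mu b c) - mu (mu a b) c else 0.
Proof.
move=> char0 xC; rewrite MC_term_tuples //=.
rewrite (sum_bool_tuple2 (fun bs => (l_hom lambda (map (slot x) bs)).1 w)) /=.
rewrite !addr0 expr1 mulrN1 scaleNr gbracket_product //.
case: w => [|a [|b [|c [|d w]]]]; rewrite ?scaler0 ?oppr0 //.
by rewrite scale_invn_mulrn // opprB.
Qed.

(** The factor 1/2! cancels the two positions of the product. *)
Lemma MC_term2_operator (k : fieldType) (V : lmodType k) (lambda : k)
    (x : cochain (deg0 V)) w (mu := (of_cochain x).1) (T := (of_cochain x).2) :
  [pchar k] =i pred0 -> C_RBA (deg0 V) (-1) x ->
  (MC_term lambda x 2).2 w =
  if w is [:: a; b] then - (lambda *: T (mu a b)) else 0.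
Proof.
move=> char0 xC; rewrite MC_term_tuples //=.
rewrite (sum_bool_tuple2 (fun bs => (l_hom lambda (map (slot x) bs)).2 w)).
have := @l_hom_slot_mixed _ _ lambda x 0 1 w isT; rewrite [_ ++ _]/= => ->.
have := @l_hom_slot_mixed _ _ lambda x 1 0 w isT; rewrite [_ ++ _]/= => ->.
rewrite l_mixed_operator1 //= add0r addr0 -mulr2n expr1 mulrN1 scaleNr.
rewrite scale_invn_mulrn //.
by case: w => [|a [|b [|c w]]]; rewrite ?oppr0.
Qed.

(** The factor 1/3! cancels the three positions of the product times the two
    permutations of the operators. *)
Lemma MC_term3_operator (k : fieldType) (V : lmodType k) (lambda : k)
    (x : cochain (deg0 V)) w (mu := (of_cochain x).1) (T := (of_cochain x).2) :
  [pchar k] =i pred0 -> C_RBA (deg0 V) (-1) x ->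
  (MC_term lambda x 3).2 w =
  if w is [:: a; b] then mu (T a) (T b) - T (mu a (T b) + mu (T a) b) else 0.
Proof.
move=> char0 xC; rewrite MC_term_tuples //=.
rewrite (sum_bool_tuple3 (fun bs => (l_hom lambda (map (slot x) bs)).2 w)) big_bool.
have := @l_hom_slot_mixed _ _ lambda x 0 2 w isT; rewrite [_ ++ _]/= => ->.
have := @l_hom_slot_mixed _ _ lambda x 1 1 w isT; rewrite [_ ++ _]/= => ->.
have := @l_hom_slot_mixed _ _ lambda x 2 0 w isT; rewrite [_ ++ _]/= => ->.
rewrite l_mixed_operator2 //= !add0r !addr0 -signr_odd /= expr1 mulrN1 scaleNr.
case: w => [|a [|b [|c w]]]; rewrite ?addr0 ?scaler0 ?oppr0 //.
by rewrite -!mulrnDr scale_invn_mulrn // opprB.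
Qed.

Lemma MC_term3_product (k : fieldType) (V : lmodType k) (lambda : k)
    (x : cochain (deg0 V)) w :
  C_RBA (deg0 V) (-1) x -> (MC_term lambda x 3).1 w = 0.
Proof.
move=> xC; rewrite MC_term_tuples //=.
rewrite (sum_bool_tuple3 (fun bs => (l_hom lambda (map (slot x) bs)).1 w)) big_bool.
by rewrite /= !addr0 scaler0.
Qed.

(** * Maurer-Cartan elements and Rota-Baxter structures *)

(** Whatever the cutoff [N] chosen as witness of finiteness, the partial sum is
    the same; the cutoffs below 3 just force some of the two terms to vanish. *)
Lemma sum_two_terms (M : nmodType) (f : nat -> M) N :
  (forall n, n != 2%N -> n != 3%N -> (0 < n)%N -> f n = 0) ->
  (forall n, (N < n)%N -> f n = 0) ->
  \sum_(1 <= n < N.+1) f n = f 2%N + f 3%N.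
Proof.
move=> f0 fN; have sum4 : \sum_(1 <= n < 4) f n = f 2%N + f 3%N.
  by do 3!rewrite big_ltn //; rewrite big_geq // addr0 f0 // add0r.
have [N3|N3] := leqP 4 N.+1.
  rewrite (big_cat_nat (n := 4)) //= sum4 big_nat big1 ?addr0 // => n /andP[n4 _].
  by rewrite f0 ?gtn_eqF ?(leq_trans _ n4).
rewrite -sum4 [RHS](big_cat_nat (n := N.+1)) //=; last exact: ltnW.
rewrite [X in _ = _ + X]big_nat [X in _ = _ + X]big1 ?addr0 // => n /andP[nN _].
exact: fN.
Qed.

(** The two equations are the components of the Maurer-Cartan equation in the
    algebra part, where the term of length 3 is zero, and in the operator part. *)
Lemma MC_two_equations (k : fieldType) (V : lmodType k) (lambda : k)
    (x : cochain (deg0 V)) :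
  C_RBA (deg0 V) (-1) x ->
  MC (deg0 V) lambda x <->
  (forall w, (MC_term lambda x 2).1 w = 0) /\
  (forall w, (MC_term lambda x 2).2 w + (MC_term lambda x 3).2 w = 0).
Proof.
move=> xC.
have term0 n : n != 2%N -> n != 3%N -> (0 < n)%N ->
    MC_term lambda x n = ((fun=> 0), (fun=> 0)).
  by move=> n2 n3 n0; apply: MC_term_eq0.
have sums N : (forall n, (N < n)%N -> MC_term lambda x n = ((fun=> 0), (fun=> 0))) ->
    (forall w, \sum_(1 <= n < N.+1) (MC_term lambda x n).1 w = (MC_term lambda x 2).1 w) /\
    (forall w, \sum_(1 <= n < N.+1) (MC_term lambda x n).2 w =
       (MC_term lambda x 2).2 w + (MC_term lambda x 3).2 w).
  move=> termN; split=> w.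
    rewrite (sum_two_terms (f := fun n => (MC_term lambda x n).1 w)).
    - by rewrite MC_term3_product // addr0.
    - by move=> n n2 n3 n0; rewrite term0.
    - by move=> n nN; rewrite termN.
  rewrite (sum_two_terms (f := fun n => (MC_term lambda x n).2 w)) //.
  - by move=> n n2 n3 n0; rewrite term0.
  - by move=> n nN; rewrite termN.
split=> [[_ [N [/sums[s1 s2] [m1 m2]]]]|[m1 m2]].
  by split=> w; [rewrite -s1|rewrite -s2].
split=> //; exists 3%N.
have term3 n : (3 < n)%N -> MC_term lambda x n = ((fun=> 0), (fun=> 0)).
  by move=> n3; apply: term0; rewrite ?gtn_eqF // (leq_trans _ n3).
have [s1 s2] := sums 3%N term3.
by split=> //; split=> w; rewrite ?s1 ?s2.
Qed.

(** On words of length 3 the equation in the algebra part is associativity; on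
    words of length 2 the equation in the operator part is the Rota-Baxter
    identity, the term of weight [lambda] coming from the operation of length 2. *)
Lemma MC_rota_baxter (k : fieldType) (char0 : [pchar k] =i pred0) (V : lmodType k)
    (lambda : k) (x : cochain (deg0 V)) :
  C_RBA (deg0 V) (-1) x ->
  MC (deg0 V) lambda x <-> rota_baxter V lambda (of_cochain x).
Proof.
move=> xC; rewrite MC_two_equations //.
move: (xC); rewrite C_RBA_deg0 => -[[ml _] [tl _]].
have Tl : linear (of_cochain x).2 by exact: (tl [::] [::]).
have termE a b :
    (MC_term lambda x 2).2 [:: a; b] + (MC_term lambda x 3).2 [:: a; b] =
    (of_cochain x).1 ((of_cochain x).2 a) ((of_cochain x).2 b) -
    (of_cochain x).2 ((of_cochain x).1 a ((of_cochain x).2 b) +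
                      (of_cochain x).1 ((of_cochain x).2 a) b +
                      lambda *: (of_cochain x).1 a b).
  rewrite MC_term2_operator // MC_term3_operator // addrC -addrA -opprD; congr (_ - _).
  by rewrite [in RHS]addrC Tl addrC.
split=> [[alg op]|[_ assoc _ rb]].
  split=> //.
  - by split=> [a|b]; [exact: (ml [:: a] [::])|exact: (ml [::] [:: b])].
  - move=> a b c; apply/eqP; rewrite -subr_eq0; apply/eqP.
    by rewrite -(alg [:: a; b; c]) MC_term2_product.
  - move=> a b; apply/eqP; rewrite -subr_eq0; apply/eqP.
    by rewrite -(op [:: a; b]) termE.
split=> w.
  rewrite MC_term2_product //.
  by case: w => [|a [|b [|c [|d w]]]] //; rewrite assoc subrr.
case: w => [|a [|b [|c w]]]; last 1 first.
- by rewrite MC_term2_operator // MC_term3_operator // addr0.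
- by rewrite MC_term2_operator // MC_term3_operator // addr0.
- by rewrite MC_term2_operator // MC_term3_operator // addr0.
by rewrite termE rb subrr.
Qed.

Definition to_cochain (k : fieldType) (V : lmodType k)
    (muT : (V -> V -> V) * (V -> V)) : cochain (deg0 V) :=
  ((fun w => if w is [:: a; b] then muT.1 a b else 0),
   (fun w => if w is [:: a] then muT.2 a else 0)).

Lemma to_cochain_C_RBA (k : fieldType) (V : lmodType k) lambda
    (muT : (V -> V -> V) * (V -> V)) :
  rota_baxter V lambda muT -> C_RBA (deg0 V) (-1) (to_cochain muT).
Proof.
move=> [[mu_r mu_l] _ Tl _]; rewrite C_RBA_deg0; split; split.
- move=> [|a [|b w1]] [|c [|d w2]] r y z /=; rewrite ?scaler0 ?addr0 //;
    [exact: mu_l | exact: mu_r | case: w1 => [|? ?] /= ..];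
    by rewrite scaler0 addr0.
- by move=> [|a [|b [|c w]]].
- move=> [|a w1] [|c w2] r y z /=; rewrite ?scaler0 ?addr0 //;
    first exact: Tl; case: w1 => [|? ?] /=; by rewrite scaler0 addr0.
- by move=> [|a [|b w]].
Qed.

(** A cochain of degree -1 is zero except on words of length 2 (algebra part) and
    length 1 (operator part). *)
Lemma of_cochain_inj (k : fieldType) (V : lmodType k) (x y : cochain (deg0 V)) :
  C_RBA (deg0 V) (-1) x -> C_RBA (deg0 V) (-1) y ->
  of_cochain x = of_cochain y -> x = y.
Proof.
rewrite C_RBA_deg0 => -[[_ x1] [_ x2]] [[_ y1] [_ y2]] [mu_eq T_eq].
rewrite [x]surjective_pairing [y]surjective_pairing; congr pair; apply/funext => w.
  have [|w2] := eqVneq (size w) 2; last by rewrite x1 ?y1.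
  by case: w => [|a [|b []]] // _; exact: (congr1 (fun f => f a b) mu_eq).
have [|w1] := eqVneq (size w) 1; last by rewrite x2 ?y2.
by case: w => [|a []] // _; exact: (congr1 (fun f => f a) T_eq).
Qed.

Theorem theorem8p2 (k : fieldType) (char0 : [pchar k] =i pred0)
    (V : lmodType k) (lambda : k) :
  C_RBA (deg0 V) (-1) =
    Hom_ar (susp (deg0 V)) (susp (deg0 V)) 2 `*` Hom_ar (susp (deg0 V)) (deg0 V) 1
  /\ set_bij (MC (deg0 V) lambda) (rota_baxter V lambda)
       (@of_cochain k V).
Proof.
split; first exact: C_RBA_deg0.
split.
- by move=> x xMC; apply/(MC_rota_baxter char0 lambda xMC.1).
- by move=> x y; rewrite !inE => -[xC _] [yC _]; exact: of_cochain_inj.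
- move=> muT rb; have xC := to_cochain_C_RBA rb.
  have ofK : of_cochain (to_cochain muT) = muT by case: (muT).
  by exists (to_cochain muT) => //; apply/(MC_rota_baxter char0 lambda xC); rewrite ofK.
Qed.
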